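(* Fix finite nonempty sets $A$ and $\Omega$, a prior $\mu_0$ on $\Omega$ with $\mu_0(\omega)>0$ for all $\omega$, and a finite message set $M$ with $|M|>\max\{|\Omega|,|A|\}$. There is a set of environments of Lebesgue measure one in $[0,1]^{2|A||\Omega|}$ such that, for every environment in this set: if cheap-talk Sender values randomization, then commitment is valuable.
   Context: An environment is a pair $(u_S,u_R)$ of functions $A\times\Omega\to[0,1]$, identified with a point of $[0,1]^{2|A||\Omega|}$. A messaging strategy is $\sigma:\Omega\to\Delta M$ and an action strategy is $\rho:M\to\Delta A$. For $i\in\{S,R\}$, $U_i(\sigma,\rho)=\sum_{\omega,m,a}\mu_0(\omega)\sigma(m|\omega)\rho(a|m)u_i(a,\omega)$. A profile $(\sigma,\rho)$ is S-BR if $\sigma\in\arg\max_{\sigma'}U_S(\sigma',\rho)$, and R-BR if $\rho\in\arg\max_{\rho'}U_R(\sigma,\rho')$. A persuasion profile is an R-BR profile; the persuasion payoff is the maximum of $U_S$ over persuasion profiles. A cheap-talk equilibrium is an S-BR and R-BR profile; the cheap-talk payoff is the maximum of $U_S$ over cheap-talk equilibria. Commitment is valuable if the persuasion payoff strictly exceeds the cheap-talk payoff. $\sigma$ is partitional if for every $\omega$ some $m$ has $\sigma(m|\omega)=1$. The partitional cheap-talk payoff is the maximum of $U_S$ over cheap-talk equilibria with partitional $\sigma$. Cheap-talk Sender values randomization if the cheap-talk payoff strictly exceeds the partitional cheap-talk payoff. *)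

(* Defs.v *)
From HB Require Import structures.
From mathcomp Require Import all_boot all_order all_algebra.
From mathcomp Require Import boolp classical_sets reals.
Set Implicit Arguments. Unset Strict Implicit. Unset Printing Implicit Defensive.
Import Order.TTheory GRing.Theory Num.Theory.
Local Open Scope ring_scope.
Local Open Scope classical_set_scope.

Section Game.
Variables (R : realType) (A Omega M : finType).

Definition is_dist (T : finType) (p : T -> R) : Prop :=
  (forall t, 0 <= p t) /\ \sum_(t : T) p t = 1.

Definition msg_strategy (sigma : Omega -> M -> R) : Prop :=
  forall w, is_dist (sigma w).

Definition act_strategy (rho : M -> A -> R) : Prop :=
  forall m, is_dist (rho m).

Variable mu0 : Omega -> R.

Definition U (u : A -> Omega -> R) (sigma : Omega -> M -> R) (rho : M -> A -> R) : R :=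
  \sum_(w : Omega) \sum_(m : M) \sum_(a : A) mu0 w * sigma w m * rho m a * u a w.

Variables (uS uR : A -> Omega -> R).

Definition S_BR sigma rho : Prop :=
  forall sigma', msg_strategy sigma' -> U uS sigma' rho <= U uS sigma rho.

Definition R_BR sigma rho : Prop :=
  forall rho', act_strategy rho' -> U uR sigma rho' <= U uR sigma rho.

Definition persuasion_profile sigma rho : Prop :=
  msg_strategy sigma /\ act_strategy rho /\ R_BR sigma rho.

Definition cheap_talk_eq sigma rho : Prop :=
  msg_strategy sigma /\ act_strategy rho /\ S_BR sigma rho /\ R_BR sigma rho.

Definition partitional (sigma : Omega -> M -> R) : Prop :=
  forall w, exists m, sigma w m = 1.

(* The maximum of U_S over the relevant profiles (taken as the supremum,
   which equals the maximum whenever the maximum exists). *)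
Definition persuasion_payoff : R :=
  sup [set x | exists sigma rho, persuasion_profile sigma rho /\ x = U uS sigma rho].

Definition cheap_talk_payoff : R :=
  sup [set x | exists sigma rho, cheap_talk_eq sigma rho /\ x = U uS sigma rho].

Definition partitional_cheap_talk_payoff : R :=
  sup [set x | exists sigma rho, cheap_talk_eq sigma rho /\ partitional sigma /\
                                  x = U uS sigma rho].

Definition commitment_valuable : Prop := cheap_talk_payoff < persuasion_payoff.

Definition values_randomization : Prop :=
  partitional_cheap_talk_payoff < cheap_talk_payoff.

End Game.

(* Environments: points of [0,1]^(2|A||Omega|), coordinates indexed by
   bool * (A * Omega): (true,(a,w)) is u_S(a,w), (false,(a,w)) is u_R(a,w). *)
Definition env_index (A Omega : finType) : finType := (bool * (A * Omega))%type.

Definition uS_of (R : realType) (A Omega : finType) (e : env_index A Omega -> R)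
  : A -> Omega -> R := fun a w => e (true, (a, w)).
Definition uR_of (R : realType) (A Omega : finType) (e : env_index A Omega -> R)
  : A -> Omega -> R := fun a w => e (false, (a, w)).

Definition unit_cube (R : realType) (I : finType) : set (I -> R) :=
  [set x | forall i, 0 <= x i <= 1].

Definition lebesgue_null (R : realType) (I : finType) (S : set (I -> R)) : Prop :=
  forall eps : R, 0 < eps ->
    exists (a b : nat -> I -> R),
      (forall n i, a n i <= b n i) /\
      (S `<=` [set x | exists n, forall i, a n i <= x i <= b n i]) /\
      (forall N, \sum_(n < N) \prod_(i : I) (b n i - a n i) <= eps).

Definition measure_one_in_cube (R : realType) (I : finType) (E : set (I -> R)) : Prop :=
  E `<=` @unit_cube R I /\ @lebesgue_null R I (@unit_cube R I `\` E).

(* Main.v *)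
(** Persuasion is a linear program over direct recommendations nu(a, w). At an
    optimum, suppose the Receiver mixes between a1 and a2 after some message with
    posterior support W. Transferring a small signed measure d on W from a1 to a2
    keeps all recommendations obedient when d is orthogonal to the payoff
    differences of the actions the Receiver finds optimal at that message, so d
    cannot change the Sender's payoff. Hence on W the Sender's difference
    uS a2 - uS a1 lies in the span of those Receiver differences. The posterior
    itself is orthogonal to that span, so the span is proper, and this happens
    only for a null set of environments.

    Thus, generically, an optimal persuasion profile has pure actions on path. If
    it is also a cheap-talk equilibrium, the Sender is indifferent in each state
    between the actions induced there, so generically each state induces a single
    action; sending one fixed message per induced action is then a partitional
    equilibrium with the same payoff. *)

Require Import Defs.
From HB Require Import structures.
From mathcomp Require Import all_boot all_order all_algebra.
From mathcomp Require Import boolp classical_sets reals.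
From mathcomp Require Import topology normedtype derive.
From mathcomp Require Import ring lra.
Import Order.TTheory GRing.Theory Num.Theory.
Import numFieldNormedType.Exports.
Set Implicit Arguments. Unset Strict Implicit. Unset Printing Implicit Defensive.
Local Open Scope ring_scope.
Local Open Scope classical_set_scope.

(** * Null sets: countable unions and Lipschitz parametrisations *)

Lemma sum_geometric_half (R : numFieldType) (x : R) n :
  \sum_(k < n) x / 2 ^+ k.+1 = x - x / 2 ^+ n.
Proof.
elim: n => [|n IH]; first by rewrite big_ord0 expr0 divr1 subrr.
by rewrite big_ord_recr /= IH !exprS; field; rewrite expf_neq0 ?pnatr_eq0.
Qed.

Lemma ler_sum_uniq_sub (R : numDomainType) (T : eqType) (s s' : seq T) (G : T -> R) :
  uniq s -> uniq s' -> {subset s <= s'} -> (forall t, 0 <= G t) ->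
  \sum_(t <- s) G t <= \sum_(t <- s') G t.
Proof.
move=> us us' ss' G0; rewrite [leRHS](bigID [in s]) /=.
rewrite -[X in _ <= X + _]big_filter [X in _ <= X + _](perm_big s) /=; last first.
  apply: uniq_perm => //; first exact: filter_uniq.
  by move=> t; rewrite mem_filter; case: (boolP (t \in s)) => //= /ss' ->.
by rewrite lerDl sumr_ge0.
Qed.

Section Null.
Variables (R : realType) (I : finType).
Implicit Types S : set (I -> R).

Lemma lebesgue_null_sub S S' : S `<=` S' -> lebesgue_null S' -> lebesgue_null S.
Proof.
move=> SS' nS' eps /nS'[a [b [ab [cov vol]]]]; exists a, b; split=> //; split=> //.
exact: subset_trans SS' cov.
Qed.

(** The [k]-th set is covered with volume at most [eps / 2 ^ k.+1], and the doubly indexed family of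
    boxes is listed along the encoding of pairs of naturals. *)
Lemma lebesgue_null_bigcup (i0 : I) (F : nat -> set (I -> R)) :
  (forall k, lebesgue_null (F k)) -> lebesgue_null (\bigcup_k F k).
Proof.
move=> nF eps eps0; pose ek k : R := eps / 2 ^+ k.+1.
have ek0 k : 0 < ek k by rewrite divr_gt0// exprn_gt0.
have /choice[ab hab] k : exists ab : (nat -> I -> R) * (nat -> I -> R),
    [/\ (forall n i, ab.1 n i <= ab.2 n i),
        F k `<=` [set x | exists n, forall i, ab.1 n i <= x i <= ab.2 n i] &
        forall N, \sum_(n < N) \prod_(i : I) (ab.2 n i - ab.1 n i) <= ek k].
  by have [a [b [h1 [h2 h3]]]] := nF k _ (ek0 k); exists (a, b).
(* Indices that encode no pair get the single point 0 as box; its volume is zero because the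
   coordinate [i0] contributes a zero factor. *)
pose bx (g : (nat -> I -> R) * (nat -> I -> R) -> nat -> I -> R) (n : nat) i :=
  if @pickle_inv (nat * nat)%type n is Some p then g (ab p.1) p.2 i else 0.
exists (bx fst), (bx snd); split; [|split].
- by move=> n i; rewrite /bx; case: pickle_inv => // -[k l]; have [->] := hab k.
- move=> x [k _ Fkx]; have [_ /(_ x Fkx)[l xl] _] := hab k.
  exists (pickle (k, l)) => i; rewrite /bx.
  by rewrite pickleK_inv; exact: xl.
move=> N; pose G (p : nat * nat) := \prod_(i : I) ((ab p.1).2 p.2 i - (ab p.1).1 p.2 i).
have G0 p : 0 <= G p.
  by apply: prodr_ge0 => i _; rewrite subr_ge0; have [->] := hab p.1.
pose s := pmap (@pickle_inv (nat * nat)%type) (iota 0 N).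
have -> : \sum_(n < N) \prod_(i : I) (bx snd n i - bx fst n i) = \sum_(p <- s) G p.
  pose vol n := \prod_(i : I) (bx snd n i - bx fst n i).
  rewrite -(big_mkord xpredT vol) /index_iota subn0 /s.
  elim: (iota 0 N) => [|n r IH]; first by rewrite !big_nil.
  rewrite big_cons IH /= /vol /bx; case: pickle_inv => [p|] /=.
    by rewrite big_cons.
  by rewrite (bigD1 i0)//= subr0 mul0r add0r.
have us : uniq s by apply: (pmap_uniq pickle_invK (iota_uniq 0 N)).
(* All pairs met among the first [N] indices lie in the square of side [K], whose rows can be summed
   one by one. *)
pose K := (\max_(p <- s) (p.1 + p.2)).+1.
pose s' := [seq (k, l) | k <- iota 0 K, l <- iota 0 K].
have us' : uniq s' by apply: allpairs_uniq; rewrite ?iota_uniq// => -[? ?] [].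
have ss' : {subset s <= s'}.
  move=> [k l] kls; apply/allpairsP; exists (k, l); split=> //.
    rewrite mem_iota /= ltnS; apply: (@leq_trans (k + l)); first exact: leq_addr.
    exact: (@leq_bigmax_seq _ _ _ (fun p => p.1 + p.2)%N (k, l)).
  rewrite mem_iota /= ltnS; apply: (@leq_trans (k + l)); first exact: leq_addl.
  exact: (@leq_bigmax_seq _ _ _ (fun p => p.1 + p.2)%N (k, l)).
apply: le_trans (ler_sum_uniq_sub us us' ss' G0) _.
rewrite big_allpairs_dep /=.
apply: (@le_trans _ _ (\sum_(k < K) ek k)).
  rewrite -(big_mkord xpredT ek) /index_iota subn0; apply: ler_sum => k _.
  have [_ _ /(_ K)] := hab k; rewrite -(big_mkord xpredT (fun l => G (k, l))).
  by rewrite /index_iota subn0.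
rewrite sum_geometric_half.
by rewrite gerBl divr_ge0 ?ltW// exprn_gt0.
Qed.

(** The count behind the covering below: about [N ^ d.-1] cells, each needing a box of side [C / N],
    leave a total volume of order [1 / N]. The factor 2 absorbs [N.+1 <= 2 * N]. *)
Lemma grid_volume (C eps : R) (N d : nat) : 0 <= C -> 0 < eps -> 0 < N%:R :> R ->
  (0 < d)%N -> (2 * C) ^+ d <= eps * N%:R ->
  N.+1%:R ^+ d.-1 * (C / N%:R) ^+ d <= eps.
Proof.
case: d => // d C0 eps0 N0 _ NC; rewrite succnK.
apply: (@le_trans _ _ ((2 * N%:R) ^+ d * (C / N%:R) ^+ d.+1)).
  apply: ler_wpM2r; first by rewrite exprn_ge0// divr_ge0// ltW.
  apply: lerXn2r; rewrite ?nnegrE ?mulr_ge0//.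
  by rewrite -natrM ler_nat mul2n -addnn -addn1 leq_add2l -(ltr_nat R).
have -> : (2 * N%:R) ^+ d * (C / N%:R) ^+ d.+1 = (2 * C) ^+ d.+1 / (2 * N%:R).
  rewrite exprSr mulrA -exprMn.
  have -> : 2 * N%:R * (C / N%:R) = 2 * C by field; rewrite gt_eqF.
  by rewrite exprSr; field; rewrite gt_eqF.
rewrite ler_pdivrMr ?mulr_gt0//; apply: le_trans NC _.
rewrite mulrCA; have : 0 <= eps * N%:R by rewrite mulr_ge0// ltW.
lra.
Qed.

(* S is the image of a bounded set of parameters of dimension one less than
   that of the ambient space: cut the parameter space into cells of size 1/N. *)
Lemma lebesgue_null_lipschitz (i0 : I) S (theta : (I -> R) -> I -> R) (K L : R) :
  0 < K -> 0 <= L ->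
  (forall x, S x -> forall i, i != i0 -> `|theta x i| <= K) ->
  (forall x y, S x -> S y -> forall delta, 0 <= delta ->
     (forall i, i != i0 -> `|theta x i - theta y i| <= delta) ->
     forall i, `|x i - y i| <= L * delta) ->
  lebesgue_null S.
Proof.
move=> K0 L0 thK thL eps eps0.
(* Cells have side [2 * K / N], so boxes have radius [L] times this and side [C / N]. *)
pose C := 4 * K * L; have C0 : 0 <= C by rewrite /C !mulr_ge0// ltW.
have [N N0 NC] : exists2 N : nat, 0 < N%:R :> R & (2 * C) ^+ #|I| <= eps * N%:R.
  exists (Num.truncn ((2 * C) ^+ #|I| / eps)).+1; first by rewrite ltr0n.
  rewrite [eps * _]mulrC -ler_pdivrMr//; apply: ltW.
  have x0 : 0 <= (2 * C) ^+ #|I| / eps by rewrite divr_ge0 ?exprn_ge0 ?mulr_ge0// ltW.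
  by have /andP[] := truncn_itv x0.
pose delta := 2 * K / N%:R.
have d0 : 0 < delta by rewrite !mulr_gt0// invr_gt0.
(* There are [N.+1] slots per axis, since a parameter equal to [K] is truncated to [N] itself. *)
pose T := {ffun {i : I | i != i0} -> 'I_N.+1}.
pose cell x : T := [ffun i => inord (Num.truncn ((theta x (val i) + K) / delta))].
have cellP x y : S x -> S y -> cell x = cell y ->
    forall i, `|x i - y i| <= L * delta.
  move=> Sx Sy /ffunP exy; apply: thL => //; first exact: ltW.
  move=> i i_neq; have := exy (exist _ i i_neq); rewrite !ffunE /= => /(congr1 val) /=.
  have bnd z : S z -> 0 <= (theta z i + K) / delta /\
      (Num.truncn ((theta z i + K) / delta) < N.+1)%N.
    move=> Sz; have := thK _ Sz _ i_neq; rewrite ler_norml => /andP[h1 h2].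
    have h0 : 0 <= (theta z i + K) / delta by apply: divr_ge0; [lra|exact: ltW].
    split=> //; rewrite ltnS -(ler_nat R); have /andP[h3 _] := truncn_itv h0.
    apply: le_trans h3 _; rewrite ler_pdivrMr// /delta mulrCA divff ?gt_eqF// mulr1; lra.
  have [x0 xN] := bnd _ Sx; have [y0 yN] := bnd _ Sy.
  rewrite !inordK// => exyi.
  have /andP[x1 x2] := truncn_itv x0; have /andP[] := truncn_itv y0.
  rewrite -exyi => y1 y2.
  rewrite -natr1 ltr_pdivrMr// mulrDl mul1r in x2.
  rewrite -natr1 ltr_pdivrMr// mulrDl mul1r in y2.
  rewrite ler_pdivlMr// in x1; rewrite ler_pdivlMr// in y1.
  by rewrite ler_norml; apply/andP; split; lra.
(* Each box is centred at some point of [S] in the cell; cells that miss [S] get a harmless default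
   centre. *)
pose rep (z : T) := xget (fun=> 0) [set x | S x /\ cell x = z].
pose r := L * delta; have r0 : 0 <= r by rewrite mulr_ge0// ltW.
pose bx (c : R) n i := if insub n is Some o then rep (@enum_val T predT o) i + c else 0.
exists (bx (- r)), (bx r); split; [|split].
- move=> n i; rewrite /bx; case: insub => // o; lra.
- move=> x Sx; exists (enum_rank (cell x)) => i.
  rewrite /bx insubT//= => hlt.
  have -> : Sub (nat_of_ord (enum_rank (cell x))) hlt = enum_rank (cell x) by exact: val_inj.
  rewrite enum_rankK.
  have [Sr er] : S (rep (cell x)) /\ cell (rep (cell x)) = cell x.
    by rewrite /rep; case: xgetP => [y -> []//|/(_ x)]; case.
  have := cellP _ _ Sx Sr (esym er) i; rewrite -/r ler_norml => /andP[]; lra.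
move=> n; pose v := (2 * r) ^+ #|I|.
have v0 : 0 <= v by rewrite exprn_ge0// mulr_ge0.
have -> : \sum_(k < n) \prod_i (bx r k i - bx (- r) k i) = v *+ minn n #|T|.
  elim: n => [|n IH]; first by rewrite big_ord0 min0n mulr0n.
  rewrite big_ord_recr /= IH /bx; case: insubP => [o lt_n _|].
    rewrite (minn_idPl lt_n) (minn_idPl (ltnW lt_n)) mulrSr; congr (_ + _).
    rewrite /v -prodr_const; apply: eq_bigr => i _; ring.
  rewrite -leqNgt => le_n; rewrite (minn_idPr le_n) (minn_idPr (leqW le_n)).
  by rewrite (bigD1 i0)//= subr0 mul0r addr0.
apply: (@le_trans _ _ (v *+ #|T|)).
  by rewrite -[leLHS]mulr_natr -[leRHS]mulr_natr ler_wpM2l// ler_nat geq_minr.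
have cT : #|T| = (N.+1 ^ #|I|.-1)%N.
  by rewrite card_ffun card_ord card_sig cardC1.
have cI : #|I| = #|I|.-1.+1 by rewrite prednK//; apply/card_gt0P; exists i0.
rewrite cT -mulr_natl natrX.
have -> : v = (C / N%:R) ^+ #|I|.
  by congr (_ ^+ _); rewrite /r /delta /C; field; rewrite gt_eqF.
by apply: grid_volume => //; rewrite cI.
Qed.
End Null.

(** * Degenerate environments *)

(* Since c vanishes at w0, only #|W| - 1 coefficients have to satisfy #|W|
   equations; the bound K makes the coefficients range over a compact set. *)
Definition degenerate (R : realType) (A Omega : finType) (W : {set Omega})
    (w0 : Omega) (a1 a2 b : A) (f : {ffun Omega -> A}) (K : nat)
    : set (env_index A Omega -> R) :=
  [set e | unit_cube e /\ [/\ w0 \in W, a1 != a2 & exists c : Omega -> R,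
    [/\ c w0 = 0, forall w, `|c w| <= K%:R &
     forall w, w \in W -> uS_of e a2 w - uS_of e a1 w =
       \sum_(v in W) c v * (uR_of e (f v) w - uR_of e b w)]]].

(** The payoffs [uS a2 w] with [w] in [W] are determined by the coefficients [c] and the other
    payoffs. Storing [c w] in their place gives parameters from which the environment is recovered
    in a Lipschitz way, and the slot of [w0] carries no information. *)
Lemma degenerate_null (R : realType) (A Omega : finType) W w0 a1 a2 b f K :
  lebesgue_null (@degenerate R A Omega W w0 a1 a2 b f K).
Proof.
have [hw|hw] := boolP ((w0 \in W) && (a1 != a2)); last first.
  apply: (@lebesgue_null_lipschitz _ _ (true, (a2, w0)) _ id 1 1) => //.
  - by move=> x [_ [h1 h2 _]]; rewrite h1 h2 in hw.
  - by move=> x y [_ [h1 h2 _]]; rewrite h1 h2 in hw.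
case/andP: hw => w0W a12.
have /choice[cc hcc] e : exists c : Omega -> R, degenerate W w0 a1 a2 b f K e ->
    [/\ c w0 = 0, forall w, `|c w| <= K%:R &
     forall w, w \in W -> uS_of e a2 w - uS_of e a1 w =
       \sum_(v in W) c v * (uR_of e (f v) w - uR_of e b w)].
  have [[_ [_ _ [c hc]]]|] := pselect (degenerate W w0 a1 a2 b f K e).
    by exists c.
  by move=> ne; exists (fun=> 0).
pose i0 : env_index A Omega := (true, (a2, w0)).
pose free (i : env_index A Omega) := (i.1 && (i.2.1 == a2)) && (i.2.2 \in W).
pose theta e i := if free i then cc e i.2.2 else e i.
(* The leading 1 bounds the change of [uS a1 w]. For each [v], 1 bounds the change of [c v] times a
   payoff difference in [-1, 1], and [2 * K] the change of that difference times [c v]. *)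
pose L : R := 1 + \sum_(v in W) (1 + 2 * K%:R).
have L1 : 1 <= L.
  by rewrite lerDl sumr_ge0// => v _; rewrite addr_ge0// mulr_ge0.
apply: (@lebesgue_null_lipschitz _ _ i0 _ theta (1 + K%:R) L).
- by rewrite ltr_pwDl.
- exact: le_trans L1.
- move=> e de i _; rewrite /theta; case: ifP => _.
    by have [_ h _] := hcc e de; apply: le_trans (h _) _; rewrite lerDr.
  case: de => /(_ i)/andP[h0 h1] _; rewrite ger0_norm//.
  by apply: le_trans h1 _; rewrite lerDl.
move=> x y dx dy delta delta0 hd i.
have notfree j : ~~ free j -> `|x j - y j| <= delta.
  move=> nfj; have := hd j; rewrite /theta (negbTE nfj); apply.
  by apply: contraNneq nfj => ->; rewrite /free /= eqxx.
have [fi|/notfree h] := boolP (free i); last first.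
  by apply: le_trans h _; rewrite ler_peMl.
case: i fi => [t [a w]]; rewrite /free /= => /andP[/andP[-> /eqP ->]] wW.
have [cx0 cxK xE] := hcc x dx; have [cy0 cyK yE] := hcc y dy.
have cxy v : v \in W -> `|cc x v - cc y v| <= delta.
  move=> vW; have [->|vw0] := eqVneq v w0; first by rewrite cx0 cy0 subrr normr0.
  have := hd (true, (a2, v)); rewrite /theta /free /= eqxx vW /=; apply.
  by rewrite /i0; apply: contraNneq vw0 => -[->].
have nf1 : `|x (true, (a1, w)) - y (true, (a1, w))| <= delta.
  by apply: notfree; rewrite /free /= (negbTE a12).
have nfR a' : `|x (false, (a', w)) - y (false, (a', w))| <= delta by exact: notfree.
pose Dx v := uR_of x (f v) w - uR_of x b w; pose Dy v := uR_of y (f v) w - uR_of y b w.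
have -> : x (true, (a2, w)) - y (true, (a2, w)) =
    (x (true, (a1, w)) - y (true, (a1, w))) +
    \sum_(v in W) (cc x v * Dx v - cc y v * Dy v).
  rewrite sumrB -(xE w wW) -(yE w wW) /uS_of; ring.
apply: le_trans (ler_normD _ _) _; rewrite /L mulrDl mul1r; apply: lerD => //.
apply: le_trans (ler_norm_sum _ _ _) _; rewrite mulr_suml; apply: ler_sum => v vW.
have -> : cc x v * Dx v - cc y v * Dy v =
    (cc x v - cc y v) * Dx v + cc y v * (Dx v - Dy v) by ring.
apply: le_trans (ler_normD _ _) _; rewrite !normrM mulrDl mul1r; apply: lerD.
  rewrite -[leRHS]mulr1; apply: ler_pM => //; first exact: cxy.
  have [/(_ (false, (f v, w)))/andP[? ?] _] := dx.
  have [/(_ (false, (b, w)))/andP[? ?] _] := dx.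
  by rewrite /Dx /uR_of ler_norml; apply/andP; split; lra.
have -> : 2 * K%:R * delta = K%:R * (2 * delta) by ring.
apply: ler_pM => //.
have := nfR (f v); have := nfR b; rewrite /Dx /Dy /uR_of !ler_norml.
by move=> /andP[? ?] /andP[? ?]; apply/andP; split; lra.
Qed.

(** * Linear algebra: orthogonality and spans *)

(** Being orthogonal to the annihilator of the rows [r b] puts [s] in their span. As [mu] is a
    nonzero annihilator, the span has dimension below [#|W|], so a basis of rows can be indexed by
    states of [W] with at least one state left over, which serves as [w0]. *)
Lemma span_of_orthogonal (R : fieldType) (T : finType) (W : {set T}) (A : finType)
    (B : {set A}) (r : A -> T -> R) (s mu : T -> R) (b0 : A) w1 :
  w1 \in W -> mu w1 != 0 -> (forall w, w \notin W -> mu w = 0) ->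
  (forall b, b \in B -> \sum_w mu w * r b w = 0) ->
  (forall d : T -> R, (forall w, w \notin W -> d w = 0) ->
     (forall b, b \in B -> \sum_w d w * r b w = 0) -> \sum_w d w * s w = 0) ->
  exists (w0 : T) (f : {ffun T -> A}) (c : T -> R),
    [/\ w0 \in W, c w0 = 0 &
        forall w, w \in W -> s w = \sum_(v in W) c v * r (f v) w].
Proof.
move=> w1W mu1 muW muB orth.
pose X := \matrix_(i < #|B|, j < #|W|) r (enum_val i) (enum_val j).
pose sv := \row_(j < #|W|) s (enum_val j).
have sumW (d : T -> R) (g : T -> R) : (forall w, w \notin W -> d w = 0) ->
    \sum_w d w * g w = \sum_(j < #|W|) d (enum_val j) * g (enum_val j).
  move=> dW; rewrite (bigID [in W]) /= [X in _ + X]big1 ?addr0.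
    by rewrite (big_enum_val (fun w => d w * g w)).
  by move=> w /dW ->; rewrite mul0r.
(* Membership in the row space is tested on the columns of the cokernel; extended by zero outside
   [W], each is an admissible [d]. *)
have svX : (sv <= X)%MS.
  rewrite submxE; apply/eqP/matrixP => i k; rewrite ord1 mxE [RHS]mxE.
  pose d w := if w \in W then cokermx X (enum_rank_in w1W w) k else 0.
  have dE j : d (enum_val j) = cokermx X j k.
    by rewrite /d enum_valK_in enum_valP.
  have dW w : w \notin W -> d w = 0 by rewrite /d => /negbTE ->.
  have <- : \sum_w d w * s w = \sum_j sv 0 j * cokermx X j k.
    by rewrite sumW//; apply: eq_bigr => j _; rewrite dE [sv _ _]mxE mulrC.
  apply: orth => // a aB; rewrite sumW//.
  transitivity ((X *m cokermx X) (enum_rank_in aB a) k); last by rewrite mulmx_coker mxE.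
  rewrite mxE; apply: eq_bigr => j _.
  by rewrite dE [X _ _]mxE enum_rankK_in// mulrC.
have rk : (\rank X < #|W|)%N.
  rewrite ltn_neqAle rank_leq_col andbT; apply/negP => rf.
  have /row_full_inj inj : row_full X by exact: rf.
  pose mv := \col_(j < #|W|) mu (enum_val j).
  have /inj/matrixP/(_ (enum_rank_in w1W w1) 0) : X *m mv = X *m 0.
    rewrite mulmx0; apply/matrixP => i k; rewrite mxE [RHS]mxE.
    rewrite -[RHS](muB (enum_val i)) ?enum_valP// sumW//.
    by apply: eq_bigr => j _; rewrite !mxE mulrC.
  by rewrite !mxE enum_rankK_in// => /eqP; rewrite (negbTE mu1).
have /submxP[D sD] : (sv <= rowsub (maxrankfun X) X)%MS by rewrite eq_maxrowsub.
(* The first [\rank X] states of [W] label the basis rows; the state at position [\rank X] becomes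
   [w0]. *)
pose g (k : 'I_(\rank X)) : T := enum_val (widen_ord (ltnW rk) k).
have g_inj : injective g by move=> k l /enum_val_inj/(congr1 val)/= /val_inj.
pose F k : A := enum_val (maxrankfun X k).
pose f : {ffun T -> A} := [ffun v => if [pick k | g k == v] is Some k then F k else b0].
have fg k : f (g k) = F k.
  rewrite ffunE; case: pickP => [l /eqP/g_inj -> //|/(_ k)]; by rewrite eqxx.
exists (enum_val (Ordinal rk)), f, (fun v => \sum_(k | g k == v) D 0 k); split.
- exact: enum_valP.
- rewrite big1// => k /eqP/enum_val_inj/(congr1 val)/= kk.
  by have := ltn_ord k; rewrite kk ltnn.
move=> w wW; have := congr1 (fun Z : 'M_(_, _) => Z 0 (enum_rank_in wW w)) sD.
rewrite !mxE enum_rankK_in// => ->.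
under [RHS]eq_bigr do rewrite mulr_suml.
rewrite (exchange_big_dep predT)//=; apply: eq_bigr => k _.
rewrite (big_pred1 (g k)) ?fg => [|v]; last first.
  rewrite /= eq_sym andb_idl// => /eqP ->; exact: enum_valP.
by rewrite !mxE enum_rankK_in.
Qed.

(** * Finite distributions and maximisers *)

Section Distributions.
Variables (R : realType) (T : finType).
Implicit Types p q f : T -> R.

Definition dirac (t0 t : T) : R := (t == t0)%:R.

Lemma sum_dirac t0 f : \sum_t dirac t0 t * f t = f t0.
Proof.
rewrite (bigD1 t0)//= /dirac eqxx mul1r big1 ?addr0// => t /negbTE ->.
by rewrite mul0r.
Qed.

Lemma is_dist_dirac t0 : is_dist (dirac t0).
Proof.
split=> [t|]; first by rewrite /dirac ler0n.
by rewrite -[RHS](sum_dirac t0 (fun=> 1)); apply: eq_bigr => t _; rewrite mulr1.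
Qed.

Lemma is_dist_le1 p t : is_dist p -> p t <= 1.
Proof. by case=> p0 <-; rewrite (bigD1 t)//= lerDl sumr_ge0. Qed.

Lemma is_dist_support p : is_dist p -> exists t, 0 < p t.
Proof.
move=> [p0 p1]; apply: contrapT => /forallNP np.
have : \sum_t p t = 0.
  by apply: big1 => t _; apply/eqP; have /negP := np t; rewrite lt0r p0 andbT negbK.
by rewrite p1 => /eqP; rewrite oner_eq0.
Qed.

(** The gaps between the average and the values of [f] are nonnegative and average to zero, so they
    vanish on the support. *)
Lemma dist_argmax p f : is_dist p -> (forall y, f y <= \sum_t p t * f t) ->
  forall x y, 0 < p x -> f y <= f x.
Proof.
move=> [p0 p1] fle x y px; set s := \sum_t _ in fle.
suff <- : s = f x by [].
have /psumr_eq0P : forall t, true -> 0 <= p t * (s - f t).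
  by move=> t _; rewrite mulr_ge0// subr_ge0.
have -> : \sum_t p t * (s - f t) = 0.
  under eq_bigr do rewrite mulrBr.
  by rewrite sumrB -mulr_suml p1 mul1r subrr.
move=> /(_ erefl x erefl)/eqP; rewrite mulf_eq0 gt_eqF//= subr_eq0.
by move/eqP.
Qed.

Lemma dist_argmaxW p q f : is_dist p -> is_dist q ->
  (forall x y, 0 < p x -> f y <= f x) -> \sum_t q t * f t <= \sum_t p t * f t.
Proof.
move=> [p0 p1] [q0 q1] pf.
have -> : \sum_t q t * f t = \sum_x \sum_y p x * q y * f y.
  rewrite -[LHS]mul1r -p1 mulr_suml; apply: eq_bigr => x _; rewrite mulr_sumr.
  by apply: eq_bigr => y _; rewrite mulrA.
have -> : \sum_t p t * f t = \sum_x \sum_y p x * q y * f x.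
  by apply: eq_bigr => x _; rewrite -mulr_suml -mulr_sumr q1 mulr1.
apply: ler_sum => x _; apply: ler_sum => y _.
have := p0 x; rewrite le_eqVlt => /predU1P[<-|px]; first by rewrite !mul0r.
by apply: ler_wpM2l; [rewrite mulr_ge0|exact: pf].
Qed.

End Distributions.

(** Supplies the step size of a perturbation [y] against finitely many slacks [x]: the inverse of
    one plus the sum of all ratios [|y| / x]. A zero slack has a zero perturbation by assumption. *)
Lemma small_scale (R : realFieldType) (T : finType) (x y : T -> R) :
  (forall t, 0 <= x t) -> (forall t, x t = 0 -> y t = 0) ->
  exists2 eps : R, 0 < eps & forall t, eps * `|y t| <= x t.
Proof.
move=> x0 xy; pose S := 1 + \sum_t `|y t| / x t.
have q0 t : 0 <= `|y t| / x t by rewrite divr_ge0.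
have S0 : 0 < S by rewrite ltr_pwDl// sumr_ge0.
exists S^-1; first by rewrite invr_gt0.
move=> t; have := x0 t; rewrite le_eqVlt => /predU1P[xt|xt].
  by rewrite (xy t) -?xt// normr0 mulr0.
rewrite mulrC ler_pdivrMr// mulrC -ler_pdivrMr// /S (bigD1 t)//= addrCA lerDl.
by rewrite addr_ge0// sumr_ge0.
Qed.

(** * Best responses and direct recommendations *)

Section Game.
Variables (R : realType) (A Omega M : finType) (mu0 : Omega -> R).
Hypothesis mu0_gt0 : forall w, 0 < mu0 w.
Implicit Types (u uS uR : A -> Omega -> R).
Implicit Types (sigma : Omega -> M -> R) (rho : M -> A -> R).

(** The payoff from [a] at message [m], weighted by the probability of [m] instead of normalised by
    it; unsent messages then need no separate treatment. *)
Definition interim u sigma m a : R := \sum_w mu0 w * sigma w m * u a w.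

Lemma U_interim u sigma rho :
  U mu0 u sigma rho = \sum_m \sum_a rho m a * interim u sigma m a.
Proof.
rewrite /U exchange_big; apply: eq_bigr => m _; rewrite exchange_big.
apply: eq_bigr => a _; rewrite mulr_sumr; apply: eq_bigr => w _ /=.
by rewrite mulrA [rho m a * _]mulrC.
Qed.

Lemma U_statewise u sigma rho : U mu0 u sigma rho =
  \sum_w mu0 w * \sum_m sigma w m * \sum_a rho m a * u a w.
Proof.
apply: eq_bigr => w _; rewrite mulr_sumr; apply: eq_bigr => m _.
by rewrite !mulr_sumr; apply: eq_bigr => a _; rewrite !mulrA.
Qed.

(** Deviate to a pure action at the single message [m]; all other terms cancel. *)
Lemma R_BR_interim uR sigma rho : act_strategy rho -> R_BR mu0 uR sigma rho ->
  forall m a a', 0 < rho m a -> interim uR sigma m a' <= interim uR sigma m a.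
Proof.
move=> hrho br m; move=> a a'; apply: (dist_argmax (hrho m)) => {a a'} b.
pose rho' m' := if m' == m then dirac R b else rho m'.
have : act_strategy rho'.
  by move=> m'; rewrite /rho'; case: ifP => _; [exact: is_dist_dirac|exact: hrho].
move/br; rewrite !U_interim (bigD1 m)//= [leRHS](bigD1 m)//= {1}/rho' eqxx.
rewrite (sum_dirac b (interim uR sigma m)).
rewrite [X in _ + X <= _ -> _](_ : _ = \sum_(i | i != m)
    \sum_a rho i a * interim uR sigma i a) ?lerD2r//.
by apply: eq_bigr => m' /negbTE m'm; rewrite /rho' m'm.
Qed.

Lemma interim_R_BR uR sigma rho : act_strategy rho ->
  (forall m a a', 0 < rho m a -> interim uR sigma m a' <= interim uR sigma m a) ->
  R_BR mu0 uR sigma rho.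
Proof.
move=> hrho opt rho' hrho'; rewrite !U_interim; apply: ler_sum => m _.
exact: dist_argmaxW (hrho m) (hrho' m) (opt m).
Qed.

(** Deviate in the single state [w]; its positive prior weight can be divided out. *)
Lemma S_BR_statewise uS sigma rho : msg_strategy sigma -> S_BR mu0 uS sigma rho ->
  forall w m m', 0 < sigma w m ->
    \sum_a rho m' a * uS a w <= \sum_a rho m a * uS a w.
Proof.
move=> hs br w m m'.
apply: (@dist_argmax _ _ _ (fun m => \sum_a rho m a * uS a w) (hs w)) => {m m'} n.
pose sigma' w' := if w' == w then dirac R n else sigma w'.
have : msg_strategy sigma'.
  by move=> w'; rewrite /sigma'; case: ifP => _; [exact: is_dist_dirac|exact: hs].
move/br; rewrite !U_statewise (bigD1 w)//= [leRHS](bigD1 w)//= {1}/sigma' eqxx.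
rewrite (sum_dirac n (fun m => \sum_a rho m a * uS a w)).
rewrite [X in _ + X <= _ -> _](_ : _ = \sum_(i | i != w)
    mu0 i * \sum_m sigma i m * \sum_a rho m a * uS a i).
  by rewrite lerD2r ler_pM2l.
by apply: eq_bigr => w' /negbTE w'w; rewrite /sigma' w'w.
Qed.

Lemma statewise_S_BR uS sigma rho : msg_strategy sigma ->
  (forall w m m', 0 < sigma w m ->
    \sum_a rho m' a * uS a w <= \sum_a rho m a * uS a w) ->
  S_BR mu0 uS sigma rho.
Proof.
move=> hs opt sigma' hs'; rewrite !U_statewise; apply: ler_sum => w _.
by rewrite ler_pM2l//; apply: dist_argmaxW (hs w) (hs' w) (opt w).
Qed.

(* nu a w is the joint probability of recommending a in state w. *)
Lemma direct_persuasion uR (nu : A -> Omega -> R) : (#|A| <= #|M|)%N -> (0 < #|A|)%N ->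
  (forall a w, 0 <= nu a w) -> (forall w, \sum_a nu a w = mu0 w) ->
  (forall a a', \sum_w nu a w * uR a' w <= \sum_w nu a w * uR a w) ->
  exists sigma rho, persuasion_profile mu0 uR sigma rho /\
    forall u, U mu0 u sigma rho = \sum_a \sum_w nu a w * u a w.
Proof.
move=> AM /card_gt0P[a0 _] nu0 nu1 obey.
(* Actions are injected into messages; messages outside the image are decoded to [a0] and carry no
   probability. *)
pose code (a : A) : M := enum_val (widen_ord AM (enum_rank a)).
have code_inj : injective code.
  by move=> a b /enum_val_inj/(congr1 val)/= /val_inj/enum_rank_inj.
pose decode m := odflt a0 [pick a | code a == m].
have codeK : cancel code decode.
  move=> a; rewrite /decode; case: pickP => [b /eqP/code_inj//|/(_ a)].
  by rewrite eqxx.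
pose sigma w m := \sum_a (code a == m)%:R * (nu a w / mu0 w).
pose rho m := dirac R (decode m).
have intE u m a : interim u sigma m a = \sum_b (code b == m)%:R * \sum_w nu b w * u a w.
  rewrite /interim /sigma.
  under eq_bigr do rewrite mulr_sumr mulr_suml.
  rewrite exchange_big; apply: eq_bigr => b _; rewrite mulr_sumr.
  by apply: eq_bigr => w _ /=; field; rewrite gt_eqF.
have hrho : act_strategy rho by move=> m; exact: is_dist_dirac.
exists sigma, rho; split; [split; [|split] => //|].
- move=> w; split=> [m|].
    by apply: sumr_ge0 => a _; rewrite mulr_ge0// ?ler0n// divr_ge0// ltW.
  rewrite exchange_big /=; under eq_bigr => a _.
    under eq_bigr => m _ do rewrite eq_sym.
    rewrite (sum_dirac (code a) (fun=> nu a w / mu0 w)).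
    over.
  by rewrite -mulr_suml nu1 divff// gt_eqF.
- apply: interim_R_BR => // m a a'; rewrite /rho /dirac ltr0n lt0b => /eqP ->.
  rewrite !intE; apply: ler_sum => b _; case: eqP => [<-|_]; last by rewrite !mul0r.
  by rewrite !mul1r codeK.
move=> u; rewrite U_interim.
under eq_bigr do rewrite sum_dirac intE.
rewrite exchange_big; apply: eq_bigr => a _ /=.
under eq_bigr => m _ do rewrite eq_sym.
by rewrite (sum_dirac (code a) (fun m => \sum_w nu a w * u (decode m) w)) codeK.
Qed.


(** * Generic optimal persuasion is pure on path *)

(** Avoidance of every degenerate relation, with no bound on [c]. For a singleton [W] it says that
    the Sender is never indifferent between two actions in a state. *)
Definition generic uS uR : Prop :=
  forall (W : {set Omega}) w0 a1 a2 b (f : {ffun Omega -> A}) (c : Omega -> R),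
    w0 \in W -> a1 != a2 -> c w0 = 0 ->
    ~ (forall w, w \in W ->
         uS a2 w - uS a1 w = \sum_(v in W) c v * (uR (f v) w - uR b w)).

(** If both [a1] and [a2] could follow [m], the profile would be compared with perturbed joint
    distributions of actions and states, for which obedience is a linear constraint. *)
Lemma optimal_pure uS uR sigma rho : generic uS uR -> (#|A| <= #|M|)%N ->
  persuasion_profile mu0 uR sigma rho ->
  (forall sigma' rho', persuasion_profile mu0 uR sigma' rho' ->
     U mu0 uS sigma' rho' <= U mu0 uS sigma rho) ->
  forall w m a1 a2, 0 < sigma w m -> 0 < rho m a1 -> 0 < rho m a2 -> a1 = a2.
Proof.
move=> gen AM [hs [hr br]] opt w1 m a1 a2 sw ra1 ra2; apply/eqP.
apply: contraT => a12.
have s0 w n : 0 <= sigma w n by have [] := hs w.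
have r0 n a : 0 <= rho n a by have [] := hr n.
have ropt := R_BR_interim hr br.
pose int := interim uR sigma m.
have int12 : int a2 = int a1 by apply/eqP; rewrite eq_le !ropt.
pose mun w := mu0 w * sigma w m.
have mun0 w : 0 <= mun w by rewrite mulr_ge0// ltW.
pose nu a w := \sum_n rho n a * (mu0 w * sigma w n).
have nu0 a w : 0 <= nu a w.
  by apply: sumr_ge0 => n _; rewrite !mulr_ge0// ltW.
have nu1 w : \sum_a nu a w = mu0 w.
  rewrite exchange_big /=; under eq_bigr do rewrite -mulr_suml (proj2 (hr _)) mul1r.
  by rewrite -mulr_sumr (proj2 (hs _)) mulr1.
have nuE u a b : \sum_w nu a w * u b w = \sum_n rho n a * interim u sigma n b.
  rewrite /nu; under eq_bigr do rewrite mulr_suml.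
  rewrite exchange_big; apply: eq_bigr => n _; rewrite mulr_sumr.
  by apply: eq_bigr => w _ /=; rewrite -!mulrA.
pose W := [set w | mun w != 0]%SET.
pose B := [set b | int b == int a1]%SET.
pose r b w := uR b w - uR a1 w; pose s w := uS a2 w - uS a1 w.
have munr b : \sum_w mun w * r b w = int b - int a1.
  by rewrite -sumrB; apply: eq_bigr => w _; rewrite mulrBr.
(* Moving mass along [d] from [a1] to [a2] stays feasible for a small step, so it cannot raise the
   Sender's payoff. *)
have ge0_orth d : (forall w, w \notin W -> d w = 0) ->
    (forall b, b \in B -> \sum_w d w * r b w = 0) -> \sum_w d w * s w <= 0.
  move=> dW dB; pose p := Num.min (rho m a1) (rho m a2).
  have p0 : 0 < p by rewrite lt_min ra1.
  have pge0 := ltW p0.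
  (* The slacks at [inl w] protect nonnegativity of the perturbed [nu], those at [inr b] obedience
     against [b]. The latter vanish only for [b] in [B], where the perturbation vanishes too. *)
  pose x (t : Omega + A) := match t with
    | inl w => p * mun w | inr b => p * (int a1 - int b) end.
  pose y (t : Omega + A) := match t with
    | inl w => d w | inr b => \sum_w d w * r b w end.
  have [|[w|b] /= /eqP|eps eps0 hx] := @small_scale R _ x y.
  - case=> [w|b] /=; apply: mulr_ge0 => //; rewrite subr_ge0; exact: ropt.
  - rewrite mulf_eq0 gt_eqF//= => mw; apply: dW; by rewrite inE negbK.
  - rewrite mulf_eq0 gt_eqF//= subr_eq0 eq_sym => ib; by apply: dB; rewrite inE.
  pose k a : R := (a == a2)%:R - (a == a1)%:R.
  have k0 a : a != a1 -> a != a2 -> k a = 0.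
    by rewrite /k => /negbTE -> /negbTE ->; rewrite subrr.
  have kn a : `|k a| <= 1.
    by rewrite /k; do 2 case: eqP => _; rewrite ?subrr ?subr0 ?sub0r ?normrN ?normr0 ?normr1.
  pose nu' a w := nu a w + eps * d w * k a.
  have rp a : (a == a1) || (a == a2) -> p <= rho m a.
    by case/orP => /eqP ->; rewrite ge_min lexx ?orbT.
  have intB a : (a == a1) || (a == a2) -> int a = int a1.
    by case/orP => /eqP ->.
  have nu'0 a w : 0 <= nu' a w.
    rewrite /nu'; have [aa|] := boolP ((a == a1) || (a == a2)); last first.
      by rewrite negb_or => /andP[h1 h2]; rewrite k0// mulr0 addr0.
    have : `|eps * d w * k a| <= nu a w.
      rewrite !normrM (gtr0_norm eps0).
      apply: (@le_trans _ _ (eps * `|d w|)); first by rewrite ler_piMr// mulr_ge0// ltW.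
      apply: le_trans (hx (inl w)) _; rewrite /= /nu (bigD1 m)//=.
      apply: (@le_trans _ _ (rho m a * mun w)); first by rewrite ler_wpM2r// rp.
      by rewrite lerDl sumr_ge0// => n _; rewrite !mulr_ge0// ltW.
    by rewrite ler_norml => /andP[]; lra.
  have nu'1 w : \sum_a nu' a w = mu0 w.
    rewrite big_split /= nu1 -mulr_sumr sumrB.
    have one (c : A) : \sum_a (a == c)%:R = 1 :> R by have [] := @is_dist_dirac R A c.
    by rewrite !one subrr mulr0 addr0.
  have nu'E u a b : \sum_w nu' a w * u b w =
      \sum_w nu a w * u b w + eps * k a * \sum_w d w * u b w.
    rewrite mulr_sumr -big_split; apply: eq_bigr => w _ /=; rewrite /nu'; ring.
  have obey a b : \sum_w nu' a w * uR b w <= \sum_w nu' a w * uR a w.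
    rewrite !nu'E !nuE.
    have term n : rho n a * interim uR sigma n b <= rho n a * interim uR sigma n a.
      have := r0 n a; rewrite le_eqVlt => /predU1P[<-|rna]; first by rewrite !mul0r.
      by rewrite ler_pM2l// ropt.
    have [aa|] := boolP ((a == a1) || (a == a2)); last first.
      rewrite negb_or => /andP[h1 h2]; rewrite k0// mulr0 !mul0r !addr0.
      by apply: ler_sum => n _; exact: term.
    (* Message [m] alone already provides this much obedience slack, as the other messages
       contribute nonnegative amounts. *)
    have G : p * (int a1 - int b) <= \sum_n rho n a * interim uR sigma n a
                                    - \sum_n rho n a * interim uR sigma n b.
      rewrite -[leRHS]sumrB (bigD1 m)//= -mulrBr -/(int a) -/(int b) (intB a aa).
      apply: (@le_trans _ _ (rho m a * (int a1 - int b))).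
        by apply: ler_wpM2r; rewrite ?rp// subr_ge0; exact: ropt.
      by rewrite lerDl sumr_ge0// => n _; rewrite subr_ge0.
    have dE : \sum_w d w * uR a w - \sum_w d w * uR b w = - \sum_w d w * r b w.
      transitivity (\sum_w d w * r a w - \sum_w d w * r b w); last first.
        by rewrite (dB a) ?inE ?intB// sub0r.
      rewrite -!sumrB.
      by apply: eq_bigr => w _; rewrite /r; ring.
    have : `|eps * k a * \sum_w d w * r b w| <= p * (int a1 - int b).
      apply: le_trans _ (hx (inr b)); rewrite !normrM (gtr0_norm eps0) /= -mulrA.
      by apply: ler_wpM2l; [exact: ltW|exact: ler_piMl].
    rewrite ler_norml => /andP[h1 h2].
    rewrite -subr_ge0 opprD addrACA -mulrBr dE mulrN.
    lra.
  have cA : (0 < #|A|)%N by apply/card_gt0P; exists a1.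
  have [sigma' [rho' [pp UE]]] := direct_persuasion AM cA nu'0 nu'1 obey.
  have := opt _ _ pp; rewrite UE.
  have -> : U mu0 uS sigma rho = \sum_a \sum_w nu a w * uS a w.
    rewrite U_interim exchange_big; apply: eq_bigr => a _ /=; by rewrite nuE.
  under eq_bigr do rewrite nu'E.
  rewrite big_split /= gerDl.
  have -> : \sum_a eps * k a * \sum_w d w * uS a w = eps * \sum_w d w * s w.
    under eq_bigr do rewrite -mulrA mulrBl.
    rewrite -mulr_sumr sumrB.
    rewrite (sum_dirac a2 (fun a => \sum_w d w * uS a w)).
    rewrite (sum_dirac a1 (fun a => \sum_w d w * uS a w)) -sumrB.
    by congr (_ * _); apply: eq_bigr => w _; rewrite mulrBr.
  by rewrite pmulr_rle0.
have [] := @span_of_orthogonal R Omega W A B r s mun a1 w1.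
- by rewrite inE gt_eqF// mulr_gt0.
- by rewrite gt_eqF// mulr_gt0.
- by move=> w; rewrite inE negbK => /eqP.
- by move=> b; rewrite inE munr => /eqP ->; rewrite subrr.
(* Both [d] and [-d] are admissible directions, which turns the inequality into an equality. *)
- move=> d dW dB; apply/eqP; rewrite eq_le ge0_orth//= -oppr_le0 -sumrN.
  under eq_bigr do rewrite -mulNr.
  apply: (ge0_orth (fun w => - d w)) => [w /dW ->|b /dB db]; first by rewrite oppr0.
  by under eq_bigr do rewrite mulNr; rewrite sumrN db oppr0.
move=> w0 [f [c [w0W c0 sE]]]; exfalso.
exact: (gen W w0 a1 a2 a1 f c).
Qed.

(** * From an optimal equilibrium to a partitional one *)

(** Only [sigma] changes: each state keeps its induced action, so the Sender has no better message,
    and pooling messages that induce the same action preserves the optimality of that action for the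
    Receiver. *)
Lemma cheap_talk_partitional uS uR sigma rho : generic uS uR -> (#|A| <= #|M|)%N ->
  cheap_talk_eq mu0 uS uR sigma rho ->
  (forall sigma' rho', persuasion_profile mu0 uR sigma' rho' ->
     U mu0 uS sigma' rho' <= U mu0 uS sigma rho) ->
  exists sigma', [/\ partitional sigma', cheap_talk_eq mu0 uS uR sigma' rho &
                     U mu0 uS sigma' rho = U mu0 uS sigma rho].
Proof.
move=> gen AM [hs [hr [sbr rbr]]] opt.
have pure := optimal_pure gen AM (conj hs (conj hr rbr)) opt.
have s0 w n : 0 <= sigma w n by have [] := hs w.
have r0 n a : 0 <= rho n a by have [] := hr n.
have /choice[mw mwP] w := is_dist_support (hs w).
have /choice[am amP] m := is_dist_support (hr m).
pose beta w := am (mw w).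
have pureE w m a b : 0 < sigma w m -> 0 < rho m a -> rho m b = dirac R a b.
  move=> sw ra; have off c : c != a -> rho m c = 0.
    move=> ca; apply/eqP; apply: contraNT ca => rc; apply/eqP.
    by apply: (pure w m) => //; rewrite lt0r rc r0.
  rewrite /dirac; have [->|/off//] := eqVneq b a.
  by have [_ <-] := hr m; rewrite (bigD1 a)//= big1 ?addr0.
have sumE w m a v u : 0 < sigma w m -> 0 < rho m a -> \sum_b rho m b * u b v = u a v :> R.
  move=> sw ra; rewrite -[RHS](sum_dirac a (fun b => u b v)).
  by apply: eq_bigr => b _; rewrite (pureE w m a b).
have betaE w m a : 0 < sigma w m -> 0 < rho m a -> a = beta w.
  move=> sw ra; apply/eqP; apply: contraT => ab.
  have e : uS a w = uS (beta w) w.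
    rewrite -(sumE w m a w)// -(sumE w (mw w) (beta w) w)//.
    by apply/eqP; rewrite eq_le !(S_BR_statewise hs sbr).
  (* Two actions induced in state [w] give the Sender equal payoffs there, which is the degenerate
     relation on the singleton with zero coefficients. *)
  exfalso; apply: (@gen [set w]%SET w (beta w) a a [ffun=> a] (fun=> 0)) => //.
  - by rewrite inE.
  - by rewrite eq_sym.
  move=> v; rewrite inE => /eqP ->; rewrite e subrr big1// => t _.
  by rewrite mul0r.
pose sends a m := [exists v, 0 < sigma v m] && (0 < rho m a).
(* The chosen message depends on [w] only through [beta w]; the default is never reached. *)
pose rep w := odflt (mw w) [pick m | sends (beta w) m].
have repP w : sends (beta w) (rep w).
  rewrite /rep; case: pickP => //= /(_ (mw w)); rewrite /sends amP andbT.
  by move=> /existsP[]; exists w.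
have rep_beta w v : beta w = beta v -> rep w = rep v.
  rewrite /rep => ->; case: pickP => //= /(_ (mw v)); rewrite /sends amP andbT.
  by move=> /existsP[]; exists v.
have sendsP a m : sends a m -> forall b, rho m b = dirac R a b.
  by move=> /andP[/existsP[v sv] ra] b; exact: (pureE v).
have sends_uniq a b m : sends a m -> 0 < rho m b -> b = a.
  by move=> h rb; move: rb; rewrite (sendsP _ _ h) /dirac ltr0n lt0b => /eqP.
pose sigma' w := dirac R (rep w).
have hs' : msg_strategy sigma' by move=> w; exact: is_dist_dirac.
have sumrep w : \sum_a rho (rep w) a * uS a w = uS (beta w) w.
  have /andP[/existsP[v sv] rb] := repP w.
  exact: sumE sv rb.
exists sigma'; split.
- by move=> w; exists (rep w); rewrite /sigma' /dirac eqxx.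
- split=> //; split=> //; split.
    apply: (statewise_S_BR hs') => w m m'.
    rewrite {1}/sigma' /dirac ltr0n lt0b => /eqP ->; rewrite sumrep.
    rewrite -(sumE w (mw w) (beta w) w)//.
    exact: (S_BR_statewise hs sbr).
  apply: interim_R_BR => // m a a' ra.
  have [[w1 mE]|nrep] := pselect (exists w, m = rep w); last first.
    rewrite /interim !big1// => w _; rewrite /sigma' /dirac;
      by case: eqP => [mE|_]; [case: nrep; exists w|rewrite mulr0 mul0r].
  have ab1 : a = beta w1 by apply: sends_uniq ra; rewrite mE.
  have repE w : (m == rep w) = (beta w == a).
    apply/eqP/eqP => [mE'|bwa]; last by rewrite mE; apply: rep_beta; rewrite bwa.
    by apply/esym; apply: sends_uniq ra; rewrite mE'.
  (* On sent messages [rho n a] is 0 or 1, so it selects exactly the messages pooled into [m];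
     unsent ones contribute nothing. *)
  have intE b : interim uR sigma' m b = \sum_n rho n a * interim uR sigma n b.
    rewrite /interim; under [RHS]eq_bigr do rewrite mulr_sumr.
    rewrite exchange_big; apply: eq_bigr => w _ /=.
    rewrite /sigma' /dirac repE.
    transitivity (\sum_n sigma w n * (mu0 w * (beta w == a)%:R * uR b w)).
      by rewrite -mulr_suml (proj2 (hs w)) mul1r.
    apply: eq_bigr => n _; have := s0 w n; rewrite le_eqVlt => /predU1P[<-|sn].
      by rewrite !(mul0r, mulr0).
    have [c rc] := is_dist_support (hr n).
    rewrite (pureE w n c a) // (betaE w n c)// /dirac eq_sym; ring.
  rewrite !intE; apply: ler_sum => n _.
  have := r0 n a; rewrite le_eqVlt => /predU1P[<-|rna]; first by rewrite !mul0r.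
  by rewrite ler_pM2l// (R_BR_interim hr rbr).
rewrite !U_statewise; apply: eq_bigr => w _; congr (_ * _).
rewrite (sum_dirac (rep w) (fun m => \sum_a rho m a * uS a w)) sumrep.
transitivity (\sum_n sigma w n * uS (beta w) w).
  by rewrite -mulr_suml (proj2 (hs w)) mul1r.
apply: eq_bigr => n _; have := s0 w n; rewrite le_eqVlt => /predU1P[<-|sn].
  by rewrite !mul0r.
have [c rc] := is_dist_support (hr n).
by rewrite (sumE w n c w)// (betaE w n c).
Qed.

Lemma U_bounded u : exists B : R, forall sigma rho, msg_strategy sigma ->
  act_strategy rho -> U mu0 u sigma rho <= B.
Proof.
exists (\sum_w \sum_(m : M) \sum_a mu0 w * `|u a w|) => sigma rho hs hr.
apply: ler_sum => w _; apply: ler_sum => m _; apply: ler_sum => a _.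
have [s0 _] := hs w; have [r0 _] := hr m.
apply: le_trans (ler_norm _) _; rewrite -!mulrA normrM gtr0_norm// ler_pM2l//.
rewrite !normrM mulrA -[leRHS]mul1r ler_wpM2r//.
by rewrite !ger0_norm// mulr_ile1// is_dist_le1.
Qed.

End Game.

(** * Existence of a best cheap-talk equilibrium *)

Section Closed.
Variables (T : topologicalType) (R : realType).

Lemma closed_forall (J : Type) (P : J -> T -> Prop) :
  (forall j, closed [set x | P j x]) -> closed [set x | forall j, P j x].
Proof.
move=> cP; rewrite (_ : [set x | _] = \bigcap_(j in setT) [set x | P j x]).
  by apply: closed_bigI => j _; exact: cP.
by apply/seteqP; split=> x h j; [move=> _; exact: h|exact: (h j)].
Qed.

Lemma closed_imply (Q : Prop) (P : T -> Prop) :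
  (Q -> closed [set x | P x]) -> closed [set x | Q -> P x].
Proof.
have [q cP|nq _] := pselect Q.
  rewrite (_ : [set x | _] = [set x | P x]); first exact: cP.
  by apply/seteqP; split=> x /= h; [exact: h|move=> _].
rewrite (_ : [set x | _] = setT); first exact: closedT.
by apply/seteqP; split=> x //= _ /nq.
Qed.

Lemma closed_ler_fun (f g : T -> R) :
  continuous f -> continuous g -> closed [set x | f x <= g x].
Proof.
move=> cf cg; rewrite (_ : [set x | _] = (g \- f) @^-1` [set y | 0 <= y]).
  apply: preimage_closed; last exact: closed_ge.
  by move=> x _; apply: continuousB; [exact: cg|exact: cf].
by apply/seteqP; split=> x /=; rewrite subr_ge0.
Qed.

Lemma sum_continuous (I : finType) (f : I -> T -> R) :
  (forall i, continuous (f i)) -> continuous (fun x => \sum_i f i x).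
Proof. by move=> cf; apply: continuous_big => //; exact: add_continuous. Qed.

Lemma prod_continuous (f g : T -> R) :
  continuous f -> continuous g -> continuous (fun x => f x * g x).
Proof. by move=> cf cg x; exact: (continuousM (cf x) (cg x)). Qed.

Lemma const_continuous (c : R) : continuous (fun _ : T => c).
Proof. by move=> x; exact: cvg_cst. Qed.

Lemma closed_is_dist (X : finType) (s : T -> X -> R) :
  (forall t, continuous (s ^~ t)) -> closed [set x | is_dist (s x)].
Proof.
move=> cs; rewrite (_ : [set x | _] = [set x | forall t, 0 <= s x t] `&`
    ([set x | \sum_t s x t <= 1] `&` [set x | 1 <= \sum_t s x t])).
  apply: closedI; first apply: closed_forall => t.
    by apply: closed_ler_fun => //; exact: const_continuous.
  by apply: closedI; apply: closed_ler_fun; do ?exact: const_continuous;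
    exact: sum_continuous.
apply/seteqP; split=> x /= [h0 h1]; split=> //; first by rewrite h1.
by apply/eqP; rewrite eq_le; apply/andP.
Qed.

Variables (A Omega M : finType) (mu0 : Omega -> R).
Variables (s : T -> Omega -> M -> R) (r : T -> M -> A -> R).

Lemma U_continuous u (s' : T -> Omega -> M -> R) (r' : T -> M -> A -> R) :
  (forall w m, continuous (fun x => s' x w m)) ->
  (forall m a, continuous (fun x => r' x m a)) ->
  continuous (fun x => U mu0 u (s' x) (r' x)).
Proof.
move=> cs cr; apply: sum_continuous => w; apply: sum_continuous => m.
apply: sum_continuous => a.
apply: prod_continuous; last exact: const_continuous.
apply: prod_continuous; last exact: cr.
by apply: prod_continuous; [exact: const_continuous|exact: cs].
Qed.

Lemma closed_cheap_talk_eq uS uR :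
  (forall w m, continuous (fun x => s x w m)) ->
  (forall m a, continuous (fun x => r x m a)) ->
  closed [set x | cheap_talk_eq mu0 uS uR (s x) (r x)].
Proof.
move=> cs cr.
apply: closedI; first by apply: closed_forall => w; exact: closed_is_dist.
apply: closedI; first by apply: closed_forall => m; exact: closed_is_dist.
apply: closedI; apply: closed_forall => t; apply: closed_imply => _.
  by apply: closed_ler_fun; apply: U_continuous => // *; exact: const_continuous.
by apply: closed_ler_fun; apply: U_continuous => // *; exact: const_continuous.
Qed.

End Closed.

Section Maximum.
Import ArrowAsProduct.
Variables (R : realType) (A Omega M : finType) (mu0 : Omega -> R).
Variables (uS uR : A -> Omega -> R).

Let I : finType := ((Omega * M) + (M * A))%type.
Let sg (x : I -> R) w m := x (inl (w, m)).
Let rh (x : I -> R) m a := x (inr (m, a)).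

Let proj_cont i : continuous (fun x : I -> R => x i).
Proof. exact: (@proj_continuous I (fun=> R) i). Qed.

(** Equilibria form a closed subset of a product of unit intervals, compact by Tychonoff, and the
    payoff is continuous. An attained maximum is required because the purity argument applies to an
    actual profile, not to a supremum. *)
Lemma cheap_talk_max :
  (exists sigma rho, cheap_talk_eq (M := M) mu0 uS uR sigma rho) ->
  exists sigma rho, cheap_talk_eq (M := M) mu0 uS uR sigma rho /\
    forall sigma' rho', cheap_talk_eq (M := M) mu0 uS uR sigma' rho' ->
      U mu0 uS sigma' rho' <= U mu0 uS sigma rho.
Proof.
move=> [sigma0 [rho0 ct0]].
pose K := [set x : I -> R | forall i, `[0, 1]%classic (x i)].
pose C := [set x : I -> R | cheap_talk_eq mu0 uS uR (sg x) (rh x)].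
pose code (sigma : Omega -> M -> R) (rho : M -> A -> R) : I -> R := fun i =>
  match i with inl p => sigma p.1 p.2 | inr p => rho p.1 p.2 end.
have codeK sigma rho : cheap_talk_eq mu0 uS uR sigma rho -> (K `&` C) (code sigma rho).
  move=> ct; split=> // -[[w m]|[m a]] /=; have [hs [hr _]] := ct.
    by rewrite in_itv /= is_dist_le1// andbT; have [] := hs w.
  by rewrite in_itv /= is_dist_le1// andbT; have [] := hr m.
have cK : compact K.
  by apply: (@tychonoff I (fun=> R) (fun=> `[0, 1]%classic)) => i; exact: segment_compact.
have cC : closed C.
  by apply: closed_cheap_talk_eq => *; exact: proj_cont.
have [||x] := @compact_EVT_max _ R (fun x => U mu0 uS (sg x) (rh x)) (K `&` C) _
    (compact_closedI cK cC).
- by exists (code sigma0 rho0); exact: codeK.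
- by apply: continuous_subspaceT; apply: U_continuous => *; exact: proj_cont.
rewrite inE => -[_ Cx] xmax; exists (sg x), (rh x); split=> // sigma rho ct.
by have := xmax (code sigma rho); rewrite inE; apply; exact: codeK.
Qed.

End Maximum.

(** * Payoff comparison and the full-measure set *)

Lemma generic_randomization (R : realType) (A Omega M : finType) (mu0 : Omega -> R)
    (uS uR : A -> Omega -> R) :
  (forall w, 0 < mu0 w) -> (#|A| <= #|M|)%N -> generic uS uR ->
  values_randomization M mu0 uS uR -> commitment_valuable M mu0 uS uR.
Proof.
move=> mu0_gt0 AM gen; rewrite /values_randomization /commitment_valuable => vr.
rewrite ltNge; apply/negP => nocommit.
(* Without any equilibrium both cheap-talk suprema are taken over the empty set and equal 0, against
   the strict inequality [vr]. *)
have [ctex|noct] := pselect (exists sigma rho, cheap_talk_eq (M := M) mu0 uS uR sigma rho);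
  last first.
  have set00 (P : R -> Prop) : (forall x, ~ P x) -> sup [set x | P x] = 0.
    by move=> nP; rewrite (_ : [set x | P x] = set0) ?sup0//; apply/seteqP; split.
  have := vr; rewrite /partitional_cheap_talk_payoff /cheap_talk_payoff.
  rewrite !set00 ?ltxx// => x [s [r [ct _]]]; apply: noct; by exists s, r.
have [B UB] := @U_bounded R A Omega M mu0 mu0_gt0 uS.
have [sigma [rho [ct ctmax]]] := cheap_talk_max ctex.
have ctp : cheap_talk_payoff M mu0 uS uR <= U mu0 uS sigma rho.
  apply: ge_sup; first by exists (U mu0 uS sigma rho), sigma, rho.
  by move=> _ [s [r [h ->]]]; exact: ctmax.
(* When commitment has no value, the best equilibrium is also an optimal persuasion profile. *)
have opt (s : Omega -> M -> R) r : persuasion_profile mu0 uR s r ->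
    U mu0 uS s r <= U mu0 uS sigma rho.
  move=> pp; apply: le_trans ctp; apply: le_trans nocommit.
  apply: sup_upper_bound; last by exists s, r.
  split; first by exists (U mu0 uS s r), s, r.
  by exists B => _ [s' [r' [[h1 [h2 _]] ->]]]; exact: UB.
have [sigma' [part ct' UE]] := cheap_talk_partitional mu0_gt0 gen AM ct opt.
move: vr; rewrite ltNge => /negP; apply; apply: le_trans ctp _; rewrite -UE.
apply: sup_upper_bound; last by exists sigma', rho.
split; first by exists (U mu0 uS sigma' rho), sigma', rho.
by exists B => _ [s' [r' [[h1 [h2 _]] [_ ->]]]]; exact: UB.
Qed.

Theorem theorem2 (R : realType) (A Omega M : finType) (mu0 : Omega -> R)
  (hA : (0 < #|A|)%N) (hOmega : (0 < #|Omega|)%N)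
  (hmu0pos : forall w, 0 < mu0 w) (hmu0sum : \sum_(w : Omega) mu0 w = 1)
  (hM : (maxn #|Omega| #|A| < #|M|)%N) :
  exists E : set (env_index A Omega -> R),
    measure_one_in_cube E /\
    forall e, E e ->
      values_randomization M mu0 (uS_of e) (uR_of e) ->
      commitment_valuable M mu0 (uS_of e) (uR_of e).
Proof.
(* All data of a degenerate relation except [c] are countable, once [c] is bounded by a natural
   number; hence a countable union suffices. *)
pose Idx : Type := ({set Omega} * Omega * (A * A * A) * {ffun Omega -> A} * nat)%type.
pose D (i : Idx) : set (env_index A Omega -> R) :=
  let: (W, w0, (a1, a2, b), f, K) := i in degenerate W w0 a1 a2 b f K.
pose F n := if unpickle n is Some i then D i else set0.
have null0 : lebesgue_null (\bigcup_n F n).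
  case/card_gt0P: hA => a _; case/card_gt0P: hOmega => w _.
  apply: (@lebesgue_null_bigcup _ _ (true, (a, w))) => n; rewrite /F.
  case: unpickle => [[[[[W w0] [[a1 a2] b]] f] K]|]; first exact: degenerate_null.
  apply: lebesgue_null_sub (@degenerate_null R A Omega finset.set0 w a a a [ffun=> a] 0).
  exact: sub0set.
exists (@unit_cube R _ `\` \bigcup_n F n); split; first split.
- by move=> e [].
- apply: lebesgue_null_sub null0 => e [ce]; rewrite not_andP.
  by move=> [//|]; exact: contrapT.
move=> e [ce nF]; apply: generic_randomization => //.
  by apply: ltnW; apply: leq_ltn_trans hM; exact: leq_maxr.
(* A violation of genericity would place [e] in the degenerate set whose bound exceeds the sum of
   all [|c w|]. *)
move=> W w0 a1 a2 b f c w0W a12 c0 cE; apply: nF.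
have [K cK] : exists K : nat, \sum_w `|c w| <= K%:R.
  exists (Num.truncn (\sum_w `|c w|)).+1; apply: ltW.
  have S0 : 0 <= \sum_w `|c w| by apply: sumr_ge0.
  by have /andP[] := truncn_itv S0.
have De : D (W, w0, (a1, a2, b), f, K) e.
  split=> //; split=> //; exists c; split=> // w.
  by apply: le_trans cK; rewrite (bigD1 w)//= lerDl sumr_ge0.
have [n Fn] : exists n, F n = D (W, w0, (a1, a2, b), f, K).
  by exists (pickle (W, w0, (a1, a2, b), f, K)); rewrite /F pickleK.
by exists n => //; rewrite Fn.
Qed.
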